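(* Let $X$ be a topological vector space. Each convexly coercive function $G:X\to(-\infty,\infty]$ that is bounded from below attains its infimum on $X$.
   Context: Topological vector spaces are real. A convex subset $C$ of a topological vector space is convexly compact if for any non-empty index set $A$ and any family $\{F_\alpha\}_{\alpha\in A}$ of closed and convex subsets of $C$, the condition that $\bigcap_{\alpha\in D}F_\alpha\ne\emptyset$ for every non-empty finite $D\subseteq A$ implies $\bigcap_{\alpha\in A}F_\alpha\neq\emptyset$. For $G:X\to(-\infty,\infty]$ and $\lambda\in(-\infty,\infty]$, put $L_G(\lambda)=\{x\in X: G(x)\le\lambda\}$. The function $G$ is convexly coercive if $L_G(\lambda)$ is convex and closed for all $\lambda\in(-\infty,\infty]$, and there exists $\lambda_0\in(-\infty,\infty]$ such that $L_G(\lambda_0)$ is non-empty and convexly compact. *)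

(* Defs.v *)
From HB Require Import structures.
From mathcomp Require Import all_boot all_order all_algebra.
From mathcomp Require Import all_classical all_reals all_analysis.

Set Implicit Arguments.
Unset Strict Implicit.
Unset Printing Implicit Defensive.

Import Order.TTheory GRing.Theory Num.Theory.
Import numFieldNormedType.Exports.

Local Open Scope classical_set_scope.
Local Open Scope ring_scope.
Local Open Scope ereal_scope.

(* [topologicalLmodType R] is a topological vector space with no separation or
   local convexity assumption; [tvsType R] would add local convexity.

   "Closed subset of C" is read in the subspace topology of C, so that C need
   not be closed in X; for closed C this is the same as closed in X. *)
Definition convexly_compact (R : realType) (X : topologicalLmodType R)
    (C : set X) : Prop :=
  convex_set C /\
  forall (I : Type) (F : I -> set X),
    [set: I] !=set0 ->
    (forall i, [/\ F i `<=` C, closed (F i : set (subspace C))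
                 & convex_set (F i)]) ->
    (forall D : set I, finite_set D -> D !=set0 ->
      \bigcap_(i in D) F i !=set0) ->
    \bigcap_i F i !=set0.

Definition sublevel (R : realType) (X : Type) (G : X -> \bar R) (l : \bar R)
  : set X := [set x | G x <= l].

Definition convexly_coercive (R : realType) (X : topologicalLmodType R)
    (G : X -> \bar R) : Prop :=
  (forall l : \bar R, -oo < l ->
     convex_set (sublevel G l) /\ closed (sublevel G l)) /\
  (exists l0 : \bar R,
     [/\ -oo < l0, sublevel G l0 !=set0 & convexly_compact (sublevel G l0)]).

(* Main.v *)
(* The sets [L_G (min (G y) l0)], for y in X, are closed convex subsets of
   [L_G l0], and totally ordered by inclusion, so convex compactness applies to
   them; a common point x satisfies [G x <= G y] for all y. *)
Require Import Defs.
From HB Require Import structures.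
From mathcomp Require Import all_boot all_order all_algebra.
From mathcomp Require Import all_classical all_reals all_analysis.

Set Implicit Arguments.
Unset Strict Implicit.
Unset Printing Implicit Defensive.

Import Order.TTheory GRing.Theory Num.Theory.
Import numFieldNormedType.Exports.

Local Open Scope classical_set_scope.
Local Open Scope ring_scope.
Local Open Scope ereal_scope.

(** Used for the finite intersection property: a minimiser over finitely many indices lies in all
    their sublevel sets. The fixed head [x0] rules out an empty list. *)
Lemma seq_minimum (R : realType) (X : choiceType) (G : X -> \bar R) (x0 : X)
    (s : seq X) : exists z, forall y, y \in x0 :: s -> G z <= G y.
Proof.
elim: s => [|a s [z zP]]; first by exists x0 => y; rewrite inE => /eqP ->.
have [az|za] := leP (G a) (G z).
  (* [orbCA] moves [a] ahead of [x0]; the remaining case is then membership in [x0 :: s], where [zP]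
     applies. *)
  exists a => y; rewrite !inE orbCA => /predU1P[->//|ys].
  by rewrite (le_trans az)// zP// inE.
exists z => y; rewrite !inE orbCA => /predU1P[->|ys]; first exact: ltW.
by rewrite zP// inE.
Qed.

Theorem lemma4p3 (R : realType) (X : topologicalLmodType R) (G : X -> \bar R)
    (G_gtNy : forall x : X, -oo < G x)
    (G_coercive : convexly_coercive G)
    (G_bounded_below : exists m : R, forall x : X, m%:E <= G x) :
  exists x : X, G x = ereal_inf (range G).
Proof.
case: G_coercive => GL [l0 [l0_gtNy [x0 Gx0] [_ cpt]]].
have [||D Dfin _|x Fx] := cpt X (fun y => sublevel G (Order.min (G y) l0)).
- by exists x0.
- move=> y; have [cvxL clL] : convex_set (sublevel G (Order.min (G y) l0)) /\
      closed (sublevel G (Order.min (G y) l0)).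
    by apply: GL; rewrite lt_min G_gtNy.
  split=> //; last exact: closed_subspaceW.
  by move=> x; rewrite /sublevel /= le_min => /andP[].
- have [s ->] := (finite_seqP D).1 Dfin.
  (* Minimising over [x0] as well gives [G z <= G x0 <= l0], so [z] respects the cap [l0] besides
     each level [G y]. *)
  have [z zP] := seq_minimum G x0 s.
  exists z => y /= ys; rewrite /sublevel /= le_min zP ?inE ?ys ?orbT//=.
  by rewrite (le_trans _ Gx0)// zP// mem_head.
(* [G x] is a lower bound of the range and also belongs to it. *)
- exists x; apply/eqP; rewrite eq_le; apply/andP; split.
    apply: le_ereal_inf_tmp => _ [y _ <-].
    by have := Fx y I; rewrite /sublevel /= le_min => /andP[].
  by apply: ge_ereal_inf; exists (G x); first exists x.
Qed.
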